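(* Assume that the cardinal $\mathfrak{c}=2^{\aleph_0}$ is regular. Then for every generalized Luzin set $L\subseteq 2^\omega$ and every generalized Sierpiński set $S\subseteq 2^\omega$ we have $L+S\in v_0$.
   Context: For a $\sigma$-ideal $\mathcal{I}$ of subsets of $2^\omega$, a set $L\subseteq 2^\omega$ is an $\mathcal{I}$-Luzin set if $|L\cap A|<|L|$ for every $A\in\mathcal{I}$. Generalized Luzin sets are the $\mathcal{M}$-Luzin sets, where $\mathcal{M}$ is the $\sigma$-ideal of meager subsets of $2^\omega$; generalized Sierpiński sets are the $\mathcal{N}$-Luzin sets, where $\mathcal{N}$ is the $\sigma$-ideal of null subsets of $2^\omega$ (with respect to the standard product measure). A tree is a nonempty set $T\subseteq 2^{<\omega}$ closed under initial segments. Write $\mathrm{split}(T)=\{\sigma\in T:\sigma^\frown 0\in T\text{ and }\sigma^\frown 1\in T\}$ and $[T]=\{x\in 2^\omega:(\forall n\in\omega)\ x\upharpoonright n\in T\}$. $T$ is perfect if for every $\sigma\in T$ there is $\tau\in\mathrm{split}(T)$ with $\sigma\subseteq\tau$. $T$ is a Silver tree if it is perfect and for all $\sigma,\tau\in T$ with $|\sigma|=|\tau|$ and all $i\in\{0,1\}$: $\sigma^\frown i\in T\iff\tau^\frown i\in T$. A set $A\subseteq 2^\omega$ belongs to $v_0$ if for every Silver tree $T$ there is a Silver tree $T'\subseteq T$ with $[T']\cap A=\emptyset$. On $2^\omega$, $+$ is coordinatewise addition modulo $2$, and $A+B=\{a+b:a\in A,\ b\in B\}$. *)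

(* Defs.v *)
From HB Require Import structures.
From mathcomp Require Import all_boot all_order all_algebra.
From mathcomp Require Import all_classical all_reals all_analysis.
From mathcomp Require Import lra zify.
From mathcomp Require wochoice.

Set Implicit Arguments.
Unset Strict Implicit.
Unset Printing Implicit Defensive.
Import Order.TTheory GRing.Theory Num.Theory.
Import numFieldNormedType.Exports.

Local Open Scope classical_set_scope.
Local Open Scope card_scope.
Local Open Scope ring_scope.

Definition card_lt T U (A : set T) (B : set U) : Prop :=
  A #<= B /\ A #!= B.

Definition cofinal T (R : rel T) (C : set T) : Prop :=
  forall x, exists2 y, C y & R x y.

(* [R] orders [T] in the order type of the initial ordinal of cardinality
   [|T|]: for a well order, [~~ R x y] says that [y] is strictly below [x]. *)
Definition initial_well_order T (R : rel T) : Prop :=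
  wochoice.well_order R /\ forall x, card_lt [set y | ~~ R x y] [set: T].

(* [|T|] is an infinite cardinal equal to its cofinality. *)
Definition regular_card (T : Type) : Prop :=
  infinite_set [set: T] /\
  exists R : rel T, initial_well_order R /\
    forall C : set T, cofinal R C -> C #= [set: T].

Definition luzin T (I : set (set T)) (L : set T) : Prop :=
  forall A, I A -> card_lt (L `&` A) L.

Definition nowhere_dense (T : topologicalType) (A : set T) : Prop :=
  interior (closure A) = set0.

Definition meager (T : topologicalType) (A : set T) : Prop :=
  exists F : nat -> set T,
    (forall n, nowhere_dense (F n)) /\ A `<=` \bigcup_n F n.

Definition cylinder (s : seq bool) : set cantor_space :=
  [set x : cantor_space | forall i, (i < size s)%N -> x i = nth false s i].

Notation cantor_product := (g_sigma_algebraType (range cylinder)).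

Section fair_coin_measure_existence.
Variable R : realType.

Let t (n : nat) (x : R) : nat := Num.truncn (x * 2 ^+ n).
Let digits (x : R) : cantor_product := fun n => odd (t n.+1 x).
Let code (s : seq bool) : nat := foldl (fun (k : nat) (b : bool) => (k.*2 + b)%N) 0%N s.

Let t_half n x : 0 <= x -> (t n.+1 x)./2 = t n x.
Proof.
move=> x0; apply/esym/truncn_def.
have y0 : 0 <= x * 2 ^+ n by rewrite mulr_ge0 ?exprn_ge0.
have : 0 <= x * 2 ^+ n.+1 by rewrite mulr_ge0 ?exprn_ge0.
move=> /truncn_itv; rewrite -/(t n.+1 x) -[(t n.+1 x).+1%:R]natr1 => /andP[].
have -> : (t n.+1 x)%:R = (odd (t n.+1 x))%:R + (t n.+1 x)./2%:R * 2 :> R.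
  by rewrite -natrM muln2 -natrD odd_double_half.
rewrite exprS mulrCA -[(t n.+1 x)./2.+1%:R]natr1.
move: (x * _) ((t n.+1 x)./2%:R) => y k.
by case: odd => /= h1 h2; apply/andP; split; lra.
Qed.

Let digitsE s x : 0 <= x < 1 ->
  cylinder s (digits x) <-> t (size s) x = code s.
Proof.
move=> /andP[x0 x1]; elim/last_ind: s => [|s b ih].
  split=> // _; rewrite /t /= expr0 mulr1; apply: truncn_def.
  by rewrite x0.
rewrite size_rcons /code -cats1 foldl_cat /= -/(code s).
have tE : t (size s).+1 x = ((t (size s) x).*2 + digits x (size s))%N.
  by rewrite -(t_half (size s) x0) /digits addnC odd_double_half.
split=> [h|h].
  have {}ih : t (size s) x = code s.
    apply/ih => i si; have := h i; rewrite size_cat addn1 nth_cat si.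
    by apply; exact: ltnW.
  have := h (size s); rewrite size_cat addn1 nth_cat ltnn subnn /= => h1.
  by rewrite tE ih h1.
have db : digits x (size s) = b.
  by rewrite /digits h oddD odd_double; case: (b).
have /ih {}ih : t (size s) x = code s.
  by rewrite -(t_half (size s) x0) h addnC half_bit_double.
move=> i; rewrite size_cat addn1 ltnS nth_cat leq_eqVlt => /predU1P[->|si].
  by rewrite ltnn subnn.
by rewrite si; exact: ih.
Qed.

Let code_lt s : (code s < 2 ^ size s)%N.
Proof.
elim/last_ind: s => // s b ih.
by rewrite size_rcons /code -cats1 foldl_cat /= -/(code s) expnS; case: b; lia.
Qed.

Let I01 : set R := `[0, 1[%classic.
Let mI01 : measurable I01. Proof. exact: measurable_itv. Qed.
Let piece s : set R :=
  `[(code s)%:R / 2 ^+ size s, (code s).+1%:R / 2 ^+ size s[%classic.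

Let digits_cylinder s : digits @^-1` cylinder s `&` I01 = piece s.
Proof.
have p0 : 0 < 2 ^+ size s :> R by rewrite exprn_gt0.
apply/seteqP; split => x.
  case=> cx; rewrite /I01 /= in_itv /= => x01; move/digitsE: (cx) => /(_ x01).
  case/andP: x01 => x0 x1 tx.
  have y0 : 0 <= x * 2 ^+ size s by rewrite mulr_ge0 // ltW.
  have := truncn_itv y0; rewrite -/(t (size s) x) tx => /andP[h1 h2].
  by rewrite /piece /= in_itv /= ler_pdivrMr // h1 ltr_pdivlMr.
rewrite /piece /= in_itv /= ler_pdivrMr // ltr_pdivlMr // => h.
have x01 : 0 <= x < 1.
  case/andP: h => h1 h2; apply/andP; split.
    by rewrite -(pmulr_lge0 _ p0) (le_trans _ h1).
  rewrite -(ltr_pM2r p0) mul1r (lt_le_trans h2) //.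
  by rewrite -natrX ler_nat; exact: code_lt.
split; last by rewrite /I01 /= in_itv.
by apply/digitsE => //; exact: truncn_def.
Qed.

Let measurable_digits : measurable_fun I01 digits.
Proof.
apply: (@measurability _ _ _ cantor_product _ digits (range cylinder)) => // _ [_ [s _ <-] <-].
by rewrite setIC digits_cylinder; exact: measurable_itv.
Qed.

Let coin (A : set cantor_product) : \bar R :=
  lebesgue_measure (digits @^-1` A `&` I01).

Let coin0 : coin set0 = 0%E.
Proof. by rewrite /coin preimage_set0 set0I measure0. Qed.

Let coin_ge0 A : (0 <= coin A)%E.
Proof. exact: measure_ge0. Qed.

Let coin_sigma_additive : semi_sigma_additive coin.
Proof.
move=> F mF tF mUF; rewrite /coin preimage_bigcup setI_bigcupl.
apply: measure_semi_sigma_additive.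
- by move=> n; rewrite setIC; exact: measurable_digits.
- apply/trivIsetP => i j _ _ ij.
  move/trivIsetP : tF => /(_ i j Logic.I Logic.I ij) Fij.
  by rewrite setIACA -preimage_setI Fij preimage_set0 set0I.
- by apply: bigcup_measurable => n _; rewrite setIC; exact: measurable_digits.
Qed.

HB.instance Definition _ :=
  isMeasure.Build _ _ _ coin coin0 coin_ge0 coin_sigma_additive.

Lemma fair_coin_measure_exists :
  { mu : {measure set cantor_product -> \bar R} |
    forall s, mu (cylinder s) = (2 ^- size s)%:E }.
Proof.
exists coin => s; rewrite /= /coin digits_cylinder lebesgue_measure_itv /=.
have p0 : 0 < 2 ^+ size s :> R by rewrite exprn_gt0.
rewrite lte_fin ltr_pM2r ?invr_gt0 // ltr_nat ltnS leqnn -EFinD -mulrBl.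
by rewrite -natr1 addrAC subrr add0r mul1r.
Qed.

End fair_coin_measure_existence.

(* The product of the uniform measures on [{0, 1}], i.e. the only measure on the
   product sigma-algebra giving mass [2 ^- n] to each cylinder of length [n]. *)
Definition fair_coin_measure (R : realType) :
    {measure set cantor_product -> \bar R} :=
  sval (fair_coin_measure_exists R).

Lemma fair_coin_measureE (R : realType) (s : seq bool) :
  fair_coin_measure R (cylinder s) = (2 ^- size s)%:E.
Proof. exact: (svalP (fair_coin_measure_exists R)). Qed.

Definition null (R : realType) (A : set cantor_space) : Prop :=
  (fair_coin_measure R).-negligible A.

Definition is_tree (T : set (seq bool)) : Prop :=
  T !=set0 /\ forall s t, prefix s t -> T t -> T s.

Definition split_nodes (T : set (seq bool)) : set (seq bool) :=
  [set s | [/\ T s, T (rcons s false) & T (rcons s true)]].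

Definition branches (T : set (seq bool)) : set cantor_space :=
  [set x : cantor_space | forall n, T (mkseq x n)].

Definition perfect_tree (T : set (seq bool)) : Prop :=
  is_tree T /\ forall s, T s -> exists2 t, split_nodes T t & prefix s t.

Definition silver_tree (T : set (seq bool)) : Prop :=
  perfect_tree T /\
  forall s t b, T s -> T t -> size s = size t -> T (rcons s b) <-> T (rcons t b).

Definition v0 (A : set cantor_space) : Prop :=
  forall T, silver_tree T ->
    exists T', [/\ silver_tree T', T' `<=` T & branches T' `&` A = set0].

Definition cantor_add (x y : cantor_space) : cantor_space :=
  fun n => x n (+) y n.

Definition sumset (A B : set cantor_space) : set cantor_space :=
  [set cantor_add a b | a in A & b in B].

(* Main.v *)
Require Import Defs.
From mathcomp Require Import all_boot all_order all_algebra.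
From mathcomp Require Import all_classical all_reals all_analysis.
From mathcomp Require Import zify.
From mathcomp Require wochoice.

(** Inside a Silver tree one finds a point [x] and a sparse set of free
    coordinates [d 0 < d 1 < ...] such that all points of the perfect set [P] of
    those [y] that agree with [x] off the range of [d] are branches.  The gap
    after [d k] contains a block of [k] coordinates; let [G w] be the set of
    points that agree with [w] on infinitely many of these blocks.

    The summable measures of the block conditions make every [G w] null
    ([recurrent_null]), whereas every [G w] is comeager ([recurrent_comeager]).
    As [P] is rigid on the blocks, [l + s] in [P] forces [s = x + l] on all
    blocks.  Three facts follow, for [l] in [L], [s] in [S] and [l + s] in [P]:
    - if [l] is in the comeager set [G 0], then [s] is in the null set [G x];
    - for fixed [l], the point [s] lies in the null set [G (x + l)];
    - for fixed [s], the point [l] lies outside the comeager set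
      [G (1 + x + s)].

    So [P] meets [L + S] in a union of two families, indexed by [L] minus [G 0]
    and by the part of [S] in [G x].  The Luzin properties make both the index
    sets and the members smaller than the continuum, and regularity does the
    same for the union ([small_silver_sum]).

    Finally, half of the free coordinates can be frozen in continuum many
    ways, which yields disjoint Silver trees, and a set of fewer than continuum
    many points must miss one of them ([silver_avoid_small]). *)

Set Implicit Arguments.
Unset Strict Implicit.
Unset Printing Implicit Defensive.
Import Order.TTheory GRing.Theory Num.Theory.

Local Open Scope classical_set_scope.
Local Open Scope card_scope.
Local Open Scope ring_scope.

(** * Small sets and regular cardinals *)

Definition small T (A : set T) := card_lt A [set: T].

Lemma card_le_lt_trans T U V (A : set T) (B : set U) (C : set V) :
  A #<= B -> card_lt B C -> card_lt A C.
Proof.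
move=> AB [BC nBC]; split; first exact: card_le_trans BC.
apply: contraNN nBC => /card_esym; rewrite card_eq_le => /andP[CA _].
by rewrite card_eq_le BC (card_le_trans CA AB).
Qed.

(** The Luzin property bounds cardinalities by that of the Luzin set, which
    need not have full cardinality; this passes to the ambient type. *)
Lemma card_lt_small T (A B : set T) : card_lt A B -> small A.
Proof.
move=> [AB nAB]; split; first exact: card_le_trans AB (card_leT _).
apply: contraNN nAB => /card_esym; rewrite card_eq_le => /andP[TA _].
by rewrite card_eq_le AB (card_le_trans (card_leT _) TA).
Qed.

Lemma smallS T (A B : set T) : A `<=` B -> small B -> small A.
Proof. by move=> AB; apply: card_le_lt_trans; exact: subset_card_le. Qed.

Lemma small_image T (f : T -> T) (A : set T) : small A -> small (f @` A).
Proof. by apply: card_le_lt_trans; exact: card_image_le. Qed.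

Lemma small_neT T (A : set T) : small A -> exists x, ~ A x.
Proof.
move=> [_ nAT]; apply: contrapT => h; move/negP: nAT; apply.
suff -> : A = setT by exact: card_eqxx.
apply/seteqP; split=> // x _; apply: contrapT => nAx; apply: h.
by exists x.
Qed.

Section well_orders.
Variables (T : Type) (R : rel T).
Hypothesis woR : wochoice.well_order R.

Lemma well_order_min2 x y : (R x x /\ R x y) \/ (R y x /\ R y y).
Proof.
have [|z [[/asboolP zA lbz] _]] := @woR (fun u => `[< u = x \/ u = y >]).
  by exists x; apply/asboolP; left.
have zx : R z x by apply: lbz; apply/asboolP; left.
have zy : R z y by apply: lbz; apply/asboolP; right.
by case: zA => zE; rewrite zE in zx zy; [left|right].
Qed.

Lemma well_order_refl x : R x x.
Proof. by case: (well_order_min2 x x) => -[]. Qed.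

Lemma well_order_total x y : R x y \/ R y x.
Proof. by case: (well_order_min2 x y) => -[? ?]; [left|right]. Qed.

Lemma well_order_anti x y : R x y -> R y x -> x = y.
Proof.
move=> xy yx.
have [|z [_ uz]] := @woR (fun u => `[< u = x \/ u = y >]).
  by exists x; apply/asboolP; left.
have <- : z = x.
  apply: uz; split; first by apply/asboolP; left.
  by move=> u /asboolP[->|->] //; exact: well_order_refl.
apply: uz; split; first by apply/asboolP; right.
by move=> u /asboolP[->|->] //; exact: well_order_refl.
Qed.

Lemma well_order_trans x y z : R x y -> R y z -> R x z.
Proof.
move=> xy yz.
have [|m [[/asboolP mA lbm] _]] := @woR (fun u => `[<
    [\/ u = x, u = y | u = z] >]).
  by exists x; apply/asboolP; constructor 1.
have mx : R m x by apply: lbm; apply/asboolP; constructor 1.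
have my : R m y by apply: lbm; apply/asboolP; constructor 2.
have mz : R m z by apply: lbm; apply/asboolP; constructor 3.
case: mA => mE; subst m => //.
- by rewrite (well_order_anti xy mx).
- by rewrite -(well_order_anti yz my).
Qed.

End well_orders.

(** For a well order [R], [~~ R x y] reads: [y] is strictly below [x]. *)
Definition strictly_bounded T (R : rel T) (A : set T) :=
  exists x, forall y, A y -> ~~ R x y.

Section regular.
Variables (T : Type) (R : rel T).
Hypotheses (iR : initial_well_order R)
  (cR : forall C : set T, cofinal R C -> C #= [set: T]).

Let woR : wochoice.well_order R. Proof. by case: iR. Qed.

(** Unbounded sets are cofinal, hence of full cardinality by regularity; proper
    initial segments are small because the order type is initial. *)
Lemma small_bounded A : small A <-> strictly_bounded R A.
Proof.
split=> [[_ nA]|[x xA]]; last by apply: smallS (iR.2 x) => y /xA.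
apply: contrapT => nb; move/negP: nA; apply; apply: cR => x.
apply: contrapT => nx; apply: nb; exists x => y Ay; apply/negP => Rxy.
by apply: nx; exists y.
Qed.

Lemma smallU (A B : set T) : small A -> small B -> small (A `|` B).
Proof.
move=> /small_bounded[a aA] /small_bounded[b bB]; apply/small_bounded.
have [ab|ba] := well_order_total woR a b.
- exists b => y [/aA|/bB //]; apply: contraNN; exact: well_order_trans.
- exists a => y [/aA //|/bB]; apply: contraNN; exact: well_order_trans.
Qed.

(** Choosing a bound for each member gives a small, hence bounded, set of
    bounds. *)
Lemma small_bigcup (I : set T) (F : T -> set T) :
  small I -> (forall i, I i -> small (F i)) -> small (\bigcup_(i in I) F i).
Proof.
move=> sI sF.
have /choice[b bF] : forall i, exists x, I i -> forall y, F i y -> ~~ R x y.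
  move=> i; have [/sF/small_bounded[x xF]|nI] := pselect (I i).
  - by exists x.
  - by exists i.
have /small_bounded[x xb] := small_image b sI.
apply/small_bounded; exists x => y [i Ii Fiy].
have xbi : ~~ R x (b i) by apply: xb; exists i.
have [bx|] := well_order_total woR (b i) x; last by rewrite (negbTE xbi).
apply: contraNN (bF i Ii y Fiy) => xy; exact: (well_order_trans woR bx xy).
Qed.

End regular.

(** * Silver trees *)

Definition agree_off (x : cantor_space) (D : set nat) : set cantor_space :=
  [set y : cantor_space | forall i, ~ D i -> y i = x i].

Definition unbounded (D : set nat) := forall n, exists2 m, (n <= m)%N & D m.

(** Every Silver tree is of this form, with [D] the unbounded set of levels at
    which it splits. *)
Definition silver (x : cantor_space) (D : set nat) : set (seq bool) :=
  [set s | forall i, (i < size s)%N -> ~ D i -> nth false s i = x i].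

Lemma silver_rcons x D s b :
  silver x D (rcons s b) <-> silver x D s /\ (D (size s) \/ b = x (size s)).
Proof.
split=> [h|[hs hb] i].
  split=> [i si nD|].
    by rewrite -(h i) // ?size_rcons 1?ltnW // nth_rcons si.
  have [|nD] := pselect (D (size s)); first by left.
  right; rewrite -(h (size s)) ?size_rcons // nth_rcons ltnn eqxx //.
rewrite size_rcons ltnS leq_eqVlt nth_rcons => /predU1P[->|si nD].
  by rewrite ltnn eqxx; case: hb.
by rewrite si; exact: hs.
Qed.

Lemma silver_silver_tree x D : unbounded D -> silver_tree (silver x D).
Proof.
move=> uD; split; last first.
  move=> s t b sT tT st; rewrite !silver_rcons st; split=> -[_ h]; split=> //.
split; first split; first by exists [::].
  move=> s _ /prefixP[t ->] h i si nD.
  by rewrite -(h i) // ?size_cat ?nth_cat ?si // ltn_addr.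
move=> s sT; have [e se De] := uD (size s).
pose t := s ++ mkseq (fun i => x (size s + i)%N) (e - size s)%N.
have st : size t = e by rewrite size_cat size_mkseq subnKC.
have tT : silver x D t.
  move=> i; rewrite nth_cat st => ie nD; case: ltnP => si; first exact: sT.
  by rewrite nth_mkseq ?subnKC // ltn_sub2r // (leq_ltn_trans si).
exists t; last exact: prefix_prefix.
by split=> //; apply/silver_rcons; rewrite st; split=> //; left.
Qed.

Lemma branches_silver x D y :
  branches (silver x D) y -> agree_off x D y.
Proof.
by move=> yT i nD; have := yT i.+1 i; rewrite size_mkseq nth_mkseq // => ->.
Qed.

(** Homogeneity lets each level be read off from any single node: the splitting
    levels form [D], and [x] follows the only child at the other levels. *)
Lemma silver_tree_contains_silver T : silver_tree T ->
  exists x D, unbounded D /\ silver x D `<=` T.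
Proof.
move=> [[[[s0 Ts0] Tpre] Tperf] Thom].
pose D := [set n | exists2 s, split_nodes T s & size s = n].
pose x : cantor_space := fun n =>
  `[< exists s, T (rcons s true) /\ size s = n >].
have Tprc s b : T (rcons s b) -> T s by apply: Tpre; exact: prefix_rcons.
have nil : T [::] by apply: Tpre Ts0; exact: prefix0s.
have DxT s : T s -> forall b, D (size s) \/ b = x (size s) -> T (rcons s b).
  move=> Ts b [[t [Tt Tt0 Tt1] ts]|->].
    by apply/(Thom t s b) => //; case: b.
  case xE : (x (size s)).
    have /asboolP[t [Tt ts]] := xE.
    by apply/(Thom t s) => //; exact: Tprc Tt.
  (* A child of [s] exists by perfectness, and it cannot be the child [true]. *)
  have ext b' t : prefix (rcons s b') t -> T t -> T (rcons s false).
    case: b' => [pt Tt|]; last exact: Tpre.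
    suff : x (size s) by rewrite xE.
    by apply/asboolP; exists s; split=> //; exact: Tpre pt Tt.
  have [t [_ _ Tt] /prefixP[u tE]] := Tperf s Ts.
  have [b' [v uE]] : exists b' v, rcons u true = b' :: v.
    by case: u {tE} => [|b' u]; [exists true, [::]|exists b', (rcons u true)].
  move: Tt; rewrite tE rcons_cat uE -cat_rcons; apply: ext.
  exact: prefix_prefix.
have sub : silver x D `<=` T.
  elim/last_ind => // s b ih /silver_rcons[/ih Ts]; exact: DxT.
exists x, D; split=> // n.
have /Tperf[t tsp /prefixP[u tE]] : T (mkseq x n).
  by apply: sub => i; rewrite size_mkseq => ? _; rewrite nth_mkseq.
by exists (size t); [rewrite tE size_cat size_mkseq leq_addr|exists t].
Qed.

Lemma sparse_sequence (D : set nat) : unbounded D ->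
  exists d : nat -> nat, (forall k, D (d k)) /\ forall k, (d k + k < d k.+1)%N.
Proof.
move=> uD.
have /choice[g gP] : forall n, exists m, (n <= m)%N /\ D m.
  by move=> n; have [m] := uD n; exists m.
pose fix d k := if k is k'.+1 then g (d k' + k').+1 else g 0%N.
exists d; split=> [[|k]|k]; [exact: (gP _).2|exact: (gP _).2|exact: (gP _).1].
Qed.

Lemma sparse_lt d : (forall k, (d k + k < d k.+1)%N) ->
  {homo d : i j / (i < j)%N}.
Proof.
move=> hd; apply: homo_ltn => [|k]; first exact: ltn_trans.
by apply: leq_ltn_trans (hd k); exact: leq_addr.
Qed.

Lemma homo_lt_geq d : {homo d : i j / (i < j)%N} -> forall k, (k <= d k)%N.
Proof. by move=> dlt; elim=> // k ih; apply: leq_ltn_trans ih (dlt _ _ _). Qed.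

(** The values at the odd-indexed free coordinates define a map [pi].  The image
    of [X] under [pi] is small, so it misses some [z]; freezing the odd-indexed
    coordinates to [z] leaves a Silver tree without branches in [X]. *)
Lemma silver_avoid_small (X : set cantor_space) (x : cantor_space)
    (d : nat -> nat) :
  small X -> {homo d : i j / (i < j)%N} ->
  exists T, [/\ silver_tree T, T `<=` silver x (range d)
    & branches T `&` X = set0].
Proof.
move=> sX dlt.
have dge := homo_lt_geq dlt.
have dinj i j : d i = d j -> i = j.
  by case: (ltngtP i j) => // /dlt; lia.
pose pi (y : cantor_space) : cantor_space := fun k => y (d k.*2.+1).
have [z zX] := small_neT (small_image pi sX).
pose x' : cantor_space := fun i =>
  if pselect (exists k, d k.*2.+1 = i) is left e then z (projT1 (cid e))
  else x i.
have x'E k : x' (d k.*2.+1) = z k.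
  rewrite /x'; case: pselect => [e|[]]; last by exists k.
  by case: cid => j /= /dinj[]/double_inj ->.
have x'F i : ~ range d i -> x' i = x i.
  move=> nd; rewrite /x'; case: pselect => // -[k kE]; case: nd.
  by exists k.*2.+1.
exists (silver x' [set d k.*2 | k in setT]); split.
- apply: silver_silver_tree => n; exists (d n.*2); last by exists n.
  by apply: leq_trans (dge _); lia.
- move=> s sT i si nd; rewrite -x'F // sT // => -[k _ kE].
  by apply: nd; exists k.*2.
- apply/seteqP; split=> // y [/branches_silver yT Xy]; apply: zX.
  exists y => //.
  apply/funext => k; rewrite /pi yT // => -[j _ /dinj]; lia.
Qed.

(** * A null set with meager complement *)

Definition block_match (a n : nat) (w : cantor_space) : set cantor_space :=
  [set x | forall i, (a <= i < a + n)%N -> x i = w i].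

Definition recurrent (a : nat -> nat) (w : cantor_space) : set cantor_space :=
  lim_sup_set (fun k => block_match (a k) k w).

Lemma cylinder_rcons s b :
  cylinder (rcons s b) = cylinder s `&` [set x | x (size s) = b].
Proof.
apply/seteqP; split=> x.
  move=> h; split=> [i si|].
    by rewrite h ?size_rcons 1?ltnW // nth_rcons si.
  by rewrite /= h ?size_rcons // nth_rcons ltnn eqxx.
move=> [h hb] i; rewrite size_rcons ltnS leq_eqVlt nth_rcons.
by move=> /predU1P[->|si]; [rewrite ltnn eqxx|rewrite si h].
Qed.

Lemma measurable_cylinder s : measurable (cylinder s : set cantor_product).
Proof. by apply: sub_sigma_algebra; exists s. Qed.

(** Measurability and the bound are proved together by splitting the cylinders
    below the block into their two halves until they reach its start [a], where
    the set is itself a cylinder. *)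
Lemma block_match_measure (R : realType) a n w :
  measurable (block_match a n w : set cantor_product) /\
  (fair_coin_measure R (block_match a n w) <= (2 ^- n)%:E)%E.
Proof.
suff H m s : (size s + m)%N = a ->
    measurable (cylinder s `&` block_match a n w : set cantor_product) /\
    (fair_coin_measure R (cylinder s `&` block_match a n w)
      <= (2 ^- (size s + n))%:E)%E.
  have := H a [::] (add0n a).
  by rewrite (_ : cylinder [::] = setT) ?setTI //; apply/seteqP; split.
elim: m s => [|m ih] s sa.
  have -> : cylinder s `&` block_match a n w =
      cylinder (s ++ mkseq (fun i => w (a + i)%N) n).
    move: sa; rewrite addn0 => sa; apply/seteqP; split=> x.
      move=> [xs xw] i; rewrite size_cat size_mkseq nth_cat => ilt.
      case: ltnP => si; first exact: xs.
      by rewrite nth_mkseq; [rewrite xw; [congr w; lia|lia]|lia].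
    move=> h; split=> i ilt.
      by rewrite h ?size_cat ?size_mkseq ?nth_cat ?ilt // ltn_addr.
    rewrite h ?size_cat ?size_mkseq ?nth_cat; last lia.
    case: ltnP; first lia.
    by move=> si; rewrite nth_mkseq; [congr w; lia|lia].
  split; first exact: measurable_cylinder.
  by rewrite fair_coin_measureE size_cat size_mkseq.
have step b : (size (rcons s b) + m)%N = a by rewrite size_rcons -sa addnS.
have [m0 l0] := ih _ (step false); have [m1 l1] := ih _ (step true).
have -> : cylinder s `&` block_match a n w =
    (cylinder (rcons s false) `&` block_match a n w) `|`
    (cylinder (rcons s true) `&` block_match a n w).
  rewrite -setIUl; congr (_ `&` _); rewrite !cylinder_rcons -setIUr.
  rewrite (_ : _ `|` _ = setT) ?setIT //; apply/seteqP; split=> // x _ /=.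
  by case: (x _); [right|left].
split; first exact: measurableU.
apply: le_trans (measureU2 _ m0 m1) _.
apply: le_trans (leeD l0 l1) _.
rewrite !size_rcons addSn -EFinD lee_fin exprS invfM -mulrDl.
by rewrite -[2^-1]mul1r -splitr mul1r.
Qed.

(** Borel-Cantelli: the k-th block has length [k], and the measures [2 ^- k] are
    summable. *)
Lemma recurrent_null (R : realType) a w : null R (recurrent a w).
Proof.
have meas k := (block_match_measure R (a k) k w).1.
have bnd k := (block_match_measure R (a k) k w).2.
exists (recurrent a w); split=> //.
  apply: bigcap_measurable; first by exists 0%N.
  by move=> n _; apply: bigcup_measurable => k _; exact: meas.
apply: lim_sup_set_cvg0 => //.
have h := @cvg_geometric_eseries_half R 2 0.
apply: (@le_lt_trans _ _ (2 : R)%:E); last exact: ltry.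
rewrite -[(2:R)%:E](_ : (2 / 2 ^+ 0)%:E = _); last by rewrite expr0 divr1.
rewrite -(cvg_lim _ h) //; apply: lee_nneseries => [k _ _|k _].
  exact: measure_ge0.
apply: le_trans (bnd k) _; rewrite lee_fin natrX addn1 exprS invfM.
by rewrite mulrA divff // mul1r.
Qed.

Lemma nbhs_cylinder (x : cantor_space) n :
  \forall y \near x, forall i, (i < n)%N -> y i = x i.
Proof.
elim: n => [|n ih]; first by near=> y => i; rewrite ltn0.
have op : nbhs x (proj n @^-1` [set x n] : set cantor_space).
  apply: open_nbhs_nbhs; split=> //.
  by apply: open_comp => [+ _|]; [exact: proj_continuous|exact: discrete_open].
near=> y => i; rewrite ltnS leq_eqVlt => /predU1P[->|ilt].
  by near: y.
by rewrite (near ih y).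
Unshelve. all: by end_near. Qed.

(** A point that leaves [recurrent a w] misses [w] on all blocks from some index
    on.  For a fixed index this set is nowhere dense: writing [w] into the k-th
    block of a point [y] gives points that converge to [y] as [k] grows, because
    the blocks move to infinity, and for large [k] each has a neighbourhood that does
    not meet the set. *)
Lemma recurrent_comeager a w : (forall k, (k <= a k)%N) ->
  meager (~` recurrent a w).
Proof.
move=> ak.
exists (fun n => [set x | forall k, (n <= k)%N -> ~ block_match (a k) k w x]).
split=> [n|x nx]; last first.
  apply: contrapT => h; apply: nx => n _; apply: contrapT => h'.
  by apply: h; exists n => // k nk mk; apply: h'; exists k.
apply/seteqP; split=> // y yi.
pose u k : cantor_space := fun i => if (a k <= i < a k + k)%N then w i else y i.
have uy : u @ \oo --> y.
  (* The product topology is the topology of pointwise convergence. *)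
  have ptws : {ptws, u @ \oo --> y}.
    apply/(@pointwise_cvgP nat bool) => i.
    change ((fun k => u k i) @ \oo --> y i).
    apply: cvg_near_cst; exists i.+1 => // k /= ik; rewrite /u.
    by case: ifP => // /andP[]; have := ak k; lia.
  exact: ptws.
have [m _ mP] : \forall k \near \oo, interior (closure
    [set x | forall k, (n <= k)%N -> ~ block_match (a k) k w x]) (u k).
  by apply: uy; exact: nbhs_interior.
pose k := maxn n m.
have /interior_subset := mP k (leq_maxr _ _).
move/(_ _ (nbhs_cylinder (u k) (a k + k)%N)) => [v [/= vA vu]].
apply: (vA k (leq_maxl _ _)) => i /andP[i1 i2]; rewrite vu //.
by rewrite /u i1 i2.
Qed.

(** * Sums of Luzin sets *)

(** The blocks lie in the gaps of [d], so for [l + s] in [agree_off x (range d)]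
    the values of [l] on a block determine those of [s] and conversely.  Such
    pairs are collected by [l] when [l] is in the meager set [M], and by [s],
    which then lies in the null set [N], otherwise. *)
Lemma small_silver_sum (R : realType) (hc : regular_card cantor_space)
    (L S : set cantor_space)
    (hL : luzin (@meager cantor_space) L) (hS : luzin (null R) S)
    (x : cantor_space) (d : nat -> nat) (hd : forall k, (d k + k < d k.+1)%N) :
  small (agree_off x (range d) `&` sumset L S).
Proof.
case: hc => _ [r [ir cr]].
have dlt := sparse_lt hd; have dge := homo_lt_geq dlt.
pose a k := (d k).+1.
have offd k i : (a k <= i < a k + k)%N -> ~ range d i.
  move=> /andP[ki ik] [j _ jE]; move: ki ik; rewrite -jE /a => h1 h2.
  have [jk|kj] := leqP j k.
    by move: jk; rewrite leq_eqVlt => /predU1P[jk|/dlt]; [subst j|]; lia.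
  have : (d k.+1 <= d j)%N.
    by move: kj; rewrite leq_eqVlt => /predU1P[->//|/dlt/ltnW].
  by have := hd k; lia.
have onP l s k i : agree_off x (range d) (cantor_add l s) ->
    (a k <= i < a k + k)%N -> l i (+) s i = x i.
  by move=> h /offd; exact: h.
pose M := ~` recurrent a (fun=> false).
pose N := recurrent a x.
pose Ll s := L `&` ~` recurrent a (fun i => ~~ (x i (+) s i)).
pose Sl l := S `&` recurrent a (fun i => x i (+) l i).
have ak k : (k <= a k)%N by apply: leq_trans (dge k) _; rewrite /a.
apply: (@smallS _ _
  ((\bigcup_(l in L `&` M) (cantor_add l @` Sl l)) `|`
   (\bigcup_(s in S `&` N) (cantor_add^~ s @` Ll s)))); last first.
  apply: (smallU ir cr); apply: (small_bigcup ir cr).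
  - by apply: card_lt_small; apply: hL; exact: recurrent_comeager.
  - move=> l _; apply: small_image; apply: card_lt_small; apply: hS.
    exact: recurrent_null.
  - by apply: card_lt_small; apply: hS; exact: recurrent_null.
  - move=> s _; apply: small_image; apply: card_lt_small; apply: hL.
    exact: recurrent_comeager.
move=> y [Py [l Ll' [s Ss lsE]]]; subst y.
have [lG|lM] := pselect (recurrent a (fun=> false) l).
  right; exists s; first split=> //.
    move=> n _; have [k /= nk lk] := lG n Logic.I; exists k => // i ik.
    by rewrite -(onP _ _ _ _ Py ik) lk.
  (* A block of positive length is needed to contradict the match. *)
  exists l => //; split=> // /(_ 1%N Logic.I)[k /= k1 lk].
  have ik : (a k <= a k < a k + k)%N by lia.
  by have := onP _ _ _ _ Py ik; rewrite lk //; case: (x _) (s _) => -[].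
left; exists l; first by split.
exists s => //; split=> // n _; exists n => //= i ik.
by rewrite -(onP _ _ _ _ Py ik) addbC addKb.
Qed.

Theorem corollary11 (R : realType) (hc : regular_card cantor_space)
    (L S : set cantor_space)
    (hL : luzin (@meager cantor_space) L) (hS : luzin (null R) S) :
  v0 (sumset L S).
Proof.
move=> T /silver_tree_contains_silver[x [D [/sparse_sequence[d [dD hd]] xDT]]].
have [T' [sT' T'x T'X]] :=
  silver_avoid_small x (small_silver_sum hc hL hS x hd) (sparse_lt hd).
have xdD : silver x (range d) `<=` silver x D.
  by move=> s h i si nD; apply: h => // -[k _ kE]; apply: nD; rewrite -kE.
exists T'; split=> //; first by move=> s /T'x/xdD/xDT.
apply/seteqP; split=> // y [yT' LSy]; rewrite -T'X; split=> //; split=> //.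
by apply: branches_silver => n; exact/T'x/yT'.
Qed.
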